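(* Let $K$ be an algebraically closed field and $\phi: \mathbb{P}^N \to \mathbb{P}^N$ a morphism over $K$ of degree $d > 1$ such that $\phi^n$ is non-degenerate for every $n\ge1$. Then $\phi$ has periodic points with arbitrarily large primitive periods and infinitely many periodic points. In particular, there exists a constant $M$ such that for all primes $q > M$ there exist periodic points of $\phi$ of primitive period $q$.
   Context: $\phi^n$ is non-degenerate if the graph of $\phi^n$ and the diagonal in $\mathbb{P}^N\times\mathbb{P}^N$ intersect properly. A point $P$ has primitive period $q$ if $\phi^q(P)=P$ and $\phi^d(P)\neq P$ for $1\le d<q$. *)

(* Defs.v *)
From mathcomp Require Import all_boot all_order all_algebra.
From mathcomp Require Export mpoly.

Set Implicit Arguments.
Unset Strict Implicit.
Unset Printing Implicit Defensive.

Import GRing.Theory.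
Local Open Scope ring_scope.

Section KrullDimension.
Variables (T : Type) (closed : (T -> Prop) -> Prop).
Implicit Types X Y Z A B W : T -> Prop.

Definition subset_of A B := forall x, A x -> B x.

Definition strict_subset_of A B := subset_of A B /\ exists2 x, B x & ~ A x.

Definition irreducible_closed Z :=
  [/\ closed Z,
      exists x, Z x
    & forall A B, closed A -> closed B ->
        (forall x, Z x -> A x \/ B x) -> subset_of Z A \/ subset_of Z B].

Definition irreducible_component X Z :=
  [/\ irreducible_closed Z,
      subset_of Z X
    & forall W, irreducible_closed W -> subset_of W X ->
        subset_of Z W -> subset_of W Z].

(* Only the terms c 0, ..., c n matter. *)
Definition irreducible_chain X (n : nat) (c : nat -> T -> Prop) :=
  (forall i, (i <= n)%N -> irreducible_closed (c i) /\ subset_of (c i) X) /\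
  (forall i, (i < n)%N -> strict_subset_of (c i) (c i.+1)).

(* Krull dimension of a closed set X.  It is a relation because the supremum
   need not be a natural number; the empty set has no dimension. *)
Definition has_dimension X (n : nat) :=
  (exists c, irreducible_chain X n c) /\
  (forall m c, irreducible_chain X m c -> (m <= n)%N).

(* With e the dimension of the ambient space, c + e = a + b says that
   codim Z = codim X + codim Y, without truncated subtraction. *)
Definition intersect_properly X Y :=
  forall Z, irreducible_component (fun x => X x /\ Y x) Z ->
  exists a b c e : nat,
    [/\ has_dimension X a, has_dimension Y b, has_dimension Z c,
        has_dimension (fun=> True) e & (c + e = a + b)%N].

End KrullDimension.

Definition proj_space (K : fieldType) (N : nat) : Type :=
  {L : {vspace 'rV[K]_N.+1} | \dim L == 1%N}.

Section ProjectiveSpace.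
Variables (K : fieldType) (N : nat).
Local Notation PN := (proj_space K N).

Definition morphism_of_degree (d : nat) (phi : PN -> PN) : Prop :=
  exists F : 'I_N.+1 -> {mpoly K[N.+1]},
    [/\ forall i, F i \is d.-homog,
        forall x : 'rV[K]_N.+1, x != 0 -> exists i, (F i).@[x ord0] != 0
      & forall (P : PN) (x : 'rV[K]_N.+1), x \in val P -> x != 0 ->
          val (phi P) = <[\row_i (F i).@[x ord0]]>%VS].

(* The variables are x_0, ..., x_N (left summand) and y_0, ..., y_N (right
   summand). *)
Definition bihomogeneous (p : {mpoly K[N.+1 + N.+1]}) : Prop :=
  exists a b : nat, forall m, m \in msupp p ->
    (\sum_(i < N.+1) m (lshift N.+1 i) = a)%N /\
    (\sum_(i < N.+1) m (rshift N.+1 i) = b)%N.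

Definition vanishes_at (p : {mpoly K[N.+1 + N.+1]}) (PQ : PN * PN) : Prop :=
  forall x y : 'rV[K]_N.+1, x \in val PQ.1 -> x != 0 ->
    y \in val PQ.2 -> y != 0 -> p.@[row_mx x y ord0] = 0.

Definition zariski_closed (Z : PN * PN -> Prop) : Prop :=
  exists S : {mpoly K[N.+1 + N.+1]} -> Prop,
    (forall p, S p -> bihomogeneous p) /\
    (forall PQ, Z PQ <-> forall p, S p -> vanishes_at p PQ).

Definition graph (f : PN -> PN) (PQ : PN * PN) : Prop := PQ.2 = f PQ.1.

Definition diagonal (PQ : PN * PN) : Prop := PQ.1 = PQ.2.

Definition non_degenerate (f : PN -> PN) : Prop :=
  intersect_properly zariski_closed (graph f) diagonal.

End ProjectiveSpace.

Definition periodic_point (T : Type) (f : T -> T) (P : T) : Prop :=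
  exists2 n, (1 <= n)%N & iter n f P = P.

Definition primitive_period (T : Type) (f : T -> T) (q : nat) (P : T) : Prop :=
  [/\ (1 <= q)%N, iter q f P = P
    & forall d, (1 <= d < q)%N -> iter d f P <> P].

Definition infinitely_many (T : eqType) (A : T -> Prop) : Prop :=
  forall s : seq T, exists2 x, A x & x \notin s.

(* Main.v *)
(** For [D = d ^ q] let [G = (G_0, ..., G_N)] be the [q]-th iterate of a lift [F]
    of [phi], and put [n = N.+1].  The affine scheme [G x = x] in [K^n] has
    length at least a constant times [D ^ n]: the polynomial ring is a finite
    module over [K[G_0 - x_0, ..., G_N - x_N]] whose generic rank is of order
    [D ^ n], and the generic rank bounds the length of the fibre over [0] from
    below.  If every point fixed by [phi^q] were fixed by [phi], every solution
    of [G x = x] would have the form [zeta * z] with [F z = z] and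
    [zeta ^ (D - 1) = 1].  By the argument of Shub and Sullivan, for
    [q] prime and large the ideals [(G - x)] and [(F - x)] coincide locally at
    each such [z], so the local lengths are bounded independently of [q], and the
    total length is at most a constant times [D].  As [n >= 2], this is impossible
    for large [q]. *)

From HB Require Import structures.
Require Import Defs.
From mathcomp Require Import all_boot all_order all_algebra ring zify.
From Stdlib Require Import Classical.

Set Implicit Arguments.
Unset Strict Implicit.
Unset Printing Implicit Defensive.

Import GRing.Theory.
Local Open Scope ring_scope.

(** * Linear algebra *)

(** The coefficient matrix has more rows than columns, so its left kernel is nonzero. *)
Lemma linear_dependence (K : fieldType) (V : lmodType K) (A B : finType)
    (v : A -> V) (w : B -> V) (C : A -> B -> K) :
    (#|B| < #|A|)%N -> (forall a, v a = \sum_b C a b *: w b) ->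
  exists c : A -> K, (exists a, c a != 0) /\ \sum_a c a *: v a = 0.
Proof.
move=> ltBA vE.
pose M := \matrix_(i < #|A|, j < #|B|) C (enum_val i) (enum_val j).
have: kermx M != 0.
  rewrite -mxrank_eq0 mxrank_ker subn_eq0 -ltnNge.
  exact: leq_ltn_trans (rank_leq_col _) ltBA.
case/rowV0Pn=> u /sub_kermxP uM /rV0Pn [i ui].
exists (fun a => u 0 (enum_rank a)); split.
  by exists (enum_val i); rewrite enum_valK.
under eq_bigr do rewrite vE scaler_sumr.
rewrite exchange_big big1 //= => b _.
under eq_bigr do rewrite scalerA.
rewrite -scaler_suml [X in X *: _](_ : _ = (u *m M) 0 (enum_rank b)).
  by rewrite uM mxE scale0r.
rewrite mxE (reindex (@enum_val _ A)) /=; last first.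
  by exists enum_rank => x _; rewrite ?enum_valK ?enum_rankK.
by apply: eq_bigr => j _; rewrite enum_valK mxE enum_rankK.
Qed.

(** * Ideals and substitution *)

Definition is_ideal (R : comNzRingType) (I : R -> Prop) :=
  [/\ I 0, forall f g, I f -> I g -> I (f + g) & forall f g, I g -> I (f * g)].

(** For an ideal [I] this is the ideal [I + (u)]. *)
Definition adjoin (R : comNzRingType) (I : R -> Prop) (u f : R) :=
  exists g, I (f - g * u).

Lemma ideal_sum (R : comNzRingType) (I : R -> Prop) (T : Type) (r : seq T)
    (P : pred T) (F : T -> R) :
  is_ideal I -> (forall i, P i -> I (F i)) -> I (\sum_(i <- r | P i) F i).
Proof. by case=> I0 ID _ IF; elim/big_ind: _. Qed.

Lemma ideal_opp (R : comNzRingType) (I : R -> Prop) f :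
  is_ideal I -> I f -> I (- f).
Proof. by case=> _ _ IM If; rewrite -mulN1r; apply: IM. Qed.

Lemma ideal_sub (R : comNzRingType) (I : R -> Prop) f g :
  is_ideal I -> I f -> I g -> I (f - g).
Proof. by move=> II If Ig; case: (II) => _ ID _; apply: ID => //; apply: ideal_opp. Qed.

Lemma ideal_mulr (R : comNzRingType) (I : R -> Prop) f g :
  is_ideal I -> I f -> I (f * g).
Proof. by case=> _ _ IM If; rewrite mulrC; apply: IM. Qed.

Definition family_ideal (R : comNzRingType) (r : nat) (F : 'I_r -> R) (f : R) :=
  exists a : 'I_r -> R, f = \sum_i a i * F i.

Lemma family_idealP (R : comNzRingType) (r : nat) (F : 'I_r -> R) :
  is_ideal (family_ideal F).
Proof.
split.
- by exists (fun=> 0); rewrite big1 // => i _; rewrite mul0r.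
- move=> f g [a ->] [b ->]; exists (fun i => a i + b i).
  by rewrite -big_split; apply: eq_bigr => i _; rewrite mulrDl.
- move=> f g [a ->]; exists (fun i => f * a i).
  by rewrite mulr_sumr; apply: eq_bigr => i _; rewrite mulrA.
Qed.

Lemma family_ideal_mem (R : comNzRingType) (r : nat) (F : 'I_r -> R) i :
  family_ideal F (F i).
Proof.
exists (fun j => (j == i)%:R); rewrite (bigD1 i) //= eqxx mul1r big1 ?addr0 //.
by move=> j /negPf ->; rewrite mul0r.
Qed.

Lemma family_ideal_sub (R : comNzRingType) (r : nat) (F : 'I_r -> R)
    (J : R -> Prop) f :
  is_ideal J -> (forall i, J (F i)) -> family_ideal F f -> J f.
Proof.
move=> IJ JF [a ->]; apply: ideal_sum => // i _.
by case: IJ => _ _; apply.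
Qed.

Lemma adjoin_ideal (R : comNzRingType) (I : R -> Prop) u :
  is_ideal I -> is_ideal (adjoin I u).
Proof.
case=> I0 ID IM; split.
- by exists 0; rewrite mul0r subr0.
- move=> f g [a Ia] [b Ib]; exists (a + b).
  by have := ID _ _ Ia Ib; congr I; ring.
- move=> f g [a Ia]; exists (f * a).
  by have := IM f _ Ia; congr I; ring.
Qed.

Lemma sub_adjoin (R : comNzRingType) (I : R -> Prop) u f : I f -> adjoin I u f.
Proof. by move=> If; exists 0; rewrite mul0r subr0. Qed.

Lemma adjoin_mem (R : comNzRingType) (I : R -> Prop) u :
  is_ideal I -> adjoin I u u.
Proof. by case=> I0 _ _; exists 1; rewrite mul1r subrr. Qed.

(** [adjoin I u 1] says that [u] is a unit modulo [I], and products of units are units. *)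
Lemma adjoin_prod1 (R : comNzRingType) (I : R -> Prop) (T : eqType)
    (s : seq T) (l : T -> R) :
    is_ideal I -> (forall c, c \in s -> adjoin I (l c) 1) ->
  adjoin I (\prod_(c <- s) l c) 1.
Proof.
move=> II; elim: s => [|c s IH] H.
  by rewrite big_nil; apply: adjoin_mem.
rewrite big_cons; have [|g Ig] := IH.
  by move=> x xs; apply: H; rewrite inE xs orbT.
have [|h Ih] := H c; first by rewrite inE eqxx.
exists (g * h); case: II => I0 ID IM.
set p := \prod_(_ <- _) _ in Ig *.
have := ID _ _ Ig (IM (g * p) _ Ih); congr I; ring.
Qed.

Lemma mpoly_ring_ind (n : nat) (R : comNzRingType) (P : {mpoly R[n]} -> Prop) :
    (forall c, P c%:MP) -> (forall i, P 'X_i) ->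
    (forall f g, P f -> P g -> P (f + g)) ->
    (forall f g, P f -> P g -> P (f * g)) ->
  forall f, P f.
Proof.
move=> PC PX PD PM; elim/mpolyind => [|c m p _ _ Pp].
  by rewrite -mpolyC0.
apply: PD => //; rewrite -mul_mpolyC; apply: (PM) => //.
rewrite mpolyXE_id; apply: (big_ind P) => [||i _]; [by rewrite -mpolyC1|exact: PM|].
elim: (m i) => [|k IH]; first by rewrite expr0 -mpolyC1.
by rewrite exprS; apply: PM.
Qed.

Definition subst (n m : nat) (R : comNzRingType) (y : 'I_n -> {mpoly R[m]}) :=
  mmap (@mpolyC m R) y.

HB.instance Definition _ n m (R : comNzRingType) (y : 'I_n -> {mpoly R[m]}) :=
  GRing.RMorphism.copy (subst y) (mmap (@mpolyC m R) y).

Lemma substC n m (R : comNzRingType) (y : 'I_n -> {mpoly R[m]}) c :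
  subst y c%:MP = c%:MP.
Proof. exact: mmapC. Qed.

Lemma substXU n m (R : comNzRingType) (y : 'I_n -> {mpoly R[m]}) i :
  subst y 'X_i = y i.
Proof. by rewrite /subst mmapX mmap1U. Qed.

Lemma substX n m (R : comNzRingType) (y : 'I_n -> {mpoly R[m]}) e :
  subst y 'X_[e] = \prod_i y i ^+ e i.
Proof. by rewrite /subst mmapX. Qed.

Lemma substZ n m (R : comNzRingType) (y : 'I_n -> {mpoly R[m]}) c f :
  subst y (c *: f) = c *: subst y f.
Proof. by rewrite -!mul_mpolyC rmorphM /= substC. Qed.

Lemma meval_subst n m (R : comNzRingType) (y : 'I_n -> {mpoly R[m]}) f v :
  (subst y f).@[v] = f.@[fun i => (y i).@[v]].
Proof.
elim/mpoly_ring_ind: f => [c|i|f g Hf Hg|f g Hf Hg].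
- by rewrite substC !mevalC.
- by rewrite substXU mevalXU.
- by rewrite rmorphD !mevalD /= Hf Hg.
- by rewrite rmorphM !mevalM /= Hf Hg.
Qed.

Lemma subst_comp n m k (R : comNzRingType) (y : 'I_n -> {mpoly R[m]})
    (z : 'I_m -> {mpoly R[k]}) f :
  subst z (subst y f) = subst (fun i => subst z (y i)) f.
Proof.
elim/mpoly_ring_ind: f => [c|i|f g Hf Hg|f g Hf Hg].
- by rewrite !substC.
- by rewrite !substXU.
- by rewrite !rmorphD /= Hf Hg.
- by rewrite !rmorphM /= Hf Hg.
Qed.

Lemma eq_subst n m (R : comNzRingType) (y z : 'I_n -> {mpoly R[m]}) f :
  y =1 z -> subst y f = subst z f.
Proof.
move=> yz; elim/mpoly_ring_ind: f => [c|i|f g Hf Hg|f g Hf Hg].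
- by rewrite !substC.
- by rewrite !substXU.
- by rewrite !rmorphD /= Hf Hg.
- by rewrite !rmorphM /= Hf Hg.
Qed.

Lemma subst_id n (R : comNzRingType) (f : {mpoly R[n]}) :
  subst (fun i => 'X_i) f = f.
Proof.
elim/mpoly_ring_ind: f => [c|i|f g Hf Hg|f g Hf Hg].
- by rewrite !substC.
- by rewrite !substXU.
- by rewrite !rmorphD /= Hf Hg.
- by rewrite !rmorphM /= Hf Hg.
Qed.

(** A Leibniz rule for differences, for the product case of the inductions below. *)
Lemma mulr_diff (R : comNzRingType) (a b c d : R) :
  a * b - c * d = b * (a - c) + c * (b - d).
Proof. ring. Qed.

Lemma subst_congr n m (R : comNzRingType) (I : {mpoly R[m]} -> Prop)
    (y z : 'I_n -> {mpoly R[m]}) f :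
  is_ideal I -> (forall i, I (y i - z i)) -> I (subst y f - subst z f).
Proof.
move=> II yz; have [I0 ID IM] := II.
elim/mpoly_ring_ind: f => [c|i|f g Hf Hg|f g Hf Hg].
- by rewrite !substC subrr.
- by rewrite !substXU.
- by rewrite !rmorphD /= opprD addrACA; apply: ID.
- by rewrite !rmorphM /= mulr_diff; apply: ID; apply: IM.
Qed.

Lemma meval_congr n (R : comNzRingType) (I : {mpoly R[n]} -> Prop) (v : 'I_n -> R) f :
  is_ideal I -> (forall i, I ('X_i - (v i)%:MP)) -> I (f - f.@[v]%:MP).
Proof.
move=> II Iv; have := subst_congr f II Iv; rewrite subst_id; congr I.
congr (_ - _); elim/mpoly_ring_ind: f => [c|i|f g Hf Hg|f g Hf Hg].
- by rewrite substC mevalC.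
- by rewrite substXU mevalXU.
- by rewrite mevalD mpolyCD rmorphD /= Hf Hg.
- by rewrite mevalM mpolyCM rmorphM /= Hf Hg.
Qed.

(* The values [q] at [v] do not depend on [y] and [z]. *)
Lemma divided_difference n m (R : comNzRingType) (v : 'I_m -> R) (u : 'I_n -> R)
    (f : {mpoly R[n]}) :
  exists q : 'I_n -> R, forall y z : 'I_n -> {mpoly R[m]},
    (forall i, (y i).@[v] = u i) -> (forall i, (z i).@[v] = u i) ->
  exists Q : 'I_n -> {mpoly R[m]}, (forall j, (Q j).@[v] = q j) /\
    subst y f - subst z f = \sum_j Q j * (y j - z j).
Proof.
elim/mpoly_ring_ind: f => [c|i|f g [qf Hf] [qg Hg]|f g [qf Hf] [qg Hg]].
- exists (fun=> 0) => y z _ _; exists (fun=> 0); split.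
    by move=> j; rewrite meval0.
  by rewrite !substC subrr big1 // => j _; rewrite mul0r.
- exists (fun j => (j == i)%:R) => y z _ _; exists (fun j => (j == i)%:R); split.
    by move=> j; case: eqP => _; rewrite ?meval0 ?meval1.
  rewrite !substXU (bigD1 i) //= eqxx mul1r big1 ?addr0 // => j /negPf ->.
  by rewrite mul0r.
- exists (fun j => qf j + qg j) => y z yv zv.
  have [Qf [ef sf]] := Hf y z yv zv; have [Qg [eg sg]] := Hg y z yv zv.
  exists (fun j => Qf j + Qg j); split=> [j|]; first by rewrite mevalD ef eg.
  rewrite !rmorphD /= opprD addrACA sf sg -big_split /=.
  by apply: eq_bigr => j _; rewrite mulrDl.
- exists (fun j => g.@[u] * qf j + f.@[u] * qg j) => y z yv zv.
  have [Qf [ef sf]] := Hf y z yv zv; have [Qg [eg sg]] := Hg y z yv zv.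
  exists (fun j => subst y g * Qf j + subst z f * Qg j); split=> [j|].
    by rewrite mevalD !mevalM ef eg !meval_subst (meval_eq _ yv) (meval_eq _ zv).
  rewrite !rmorphM /= mulr_diff sf sg !mulr_sumr -big_split /=.
  by apply: eq_bigr => j _; rewrite mulrDl !mulrA.
Qed.

(** * Zeros of ideals *)

(** Variable by variable, some root [c] of [chi i] leaves the ideal proper after ['X_i - c] is
    adjoined. Once every variable is congruent to a constant, a nonzero value at that point would
    put a unit into the ideal. *)
Lemma finite_ideal_zero (K : closedFieldType) (n : nat)
    (I : {mpoly K[n]} -> Prop) (chi : 'I_n -> {poly K}) :
    is_ideal I -> ~ I 1 -> (forall i, chi i != 0) ->
    (forall i, I (map_poly (@mpolyC n K) (chi i)).['X_i]) ->
  exists v : 'I_n -> K, forall f, I f -> f.@[v] = 0.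
Proof.
move=> II I1 chi0 Ichi.
suff: forall s : seq 'I_n, exists (v : 'I_n -> K) (J : {mpoly K[n]} -> Prop),
    [/\ is_ideal J, forall f, I f -> J f, ~ J 1
      & forall i, i \in s -> J ('X_i - (v i)%:MP)].
  move=> /(_ (enum 'I_n)) [v [J [IJ subJ J1 Jv]]].
  exists v => f /subJ Jf; apply/eqP; apply/negP => /negP fv; apply: J1.
  have Jfv : J (f.@[v])%:MP.
    rewrite -[X in J X](subKr f); apply: ideal_sub => //.
    by apply: meval_congr => // i; apply: Jv; rewrite mem_enum.
  case: IJ => _ _ /(_ (f.@[v]^-1)%:MP _ Jfv).
  by rewrite -mpolyCM mulVf // mpolyC1.
elim=> [|i s [v [J [IJ subJ J1 Jv]]]]; first by exists (fun=> 0), I.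
have [rs chiE] := closed_field_poly_normal (chi i).
have Jrs : J (\prod_(c <- rs) ('X_i - c%:MP)).
  have := subJ _ (Ichi i); rewrite chiE map_polyZ hornerZ rmorph_prod /=.
  rewrite horner_prod; under eq_bigr do rewrite map_polyXsubC hornerXsubC.
  move=> Jp; case: (IJ) => _ _ /(_ (lead_coef (chi i))^-1%:MP _ Jp).
  by rewrite mulrA -mpolyCM mulVf ?lead_coef_eq0 // mpolyC1 mul1r.
(* If every root gave the unit ideal, the product of the ['X_i - c] would be a unit modulo [J]; but
   it lies in [J]. *)
have [c Jc] : exists c, ~ adjoin J ('X_i - c%:MP) 1.
  apply: not_all_ex_not => all1; apply: J1.
  have [g] := adjoin_prod1 (s := rs) (l := fun c => 'X_i - c%:MP) IJ
    (fun c _ => all1 c).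
  case: (IJ) => _ JD JM Jg.
  rewrite -[X in J X](subrK (g * \prod_(c <- rs) ('X_i - c%:MP))).
  by apply: JD => //; apply: JM.
exists (fun j => if j == i then c else v j), (adjoin J ('X_i - c%:MP)); split=> //.
- exact: adjoin_ideal.
- by move=> f /subJ; apply: sub_adjoin.
- move=> j; rewrite inE; case: eqP => [-> _|_ /= js]; first exact: adjoin_mem.
  by apply: sub_adjoin; apply: Jv.
Qed.

(** For nonzero polynomials [msize] is the degree plus one, so [msize g <= mdeg m] means a strict
    drop in degree, and rewriting monomials terminates below degree [e]. *)
Lemma reduce_mod_ideal (K : fieldType) (n e : nat) (I : {mpoly K[n]} -> Prop) :
    is_ideal I ->
    (forall m, (e <= mdeg m)%N ->
      exists g, (msize g <= mdeg m)%N /\ I ('X_[m] - g)) ->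
  forall f, exists g, (msize g <= e)%N /\ I (f - g).
Proof.
move=> II red f; have [I0 ID IM] := II.
suff: forall s f, (msize f <= s)%N -> exists g, (msize g <= e)%N /\ I (f - g).
  by apply.
clear f; elim=> [|s IH] f fs.
  exists f; rewrite subrr; split=> //.
  by move: fs; rewrite leqn0 msize_poly_eq0 => /eqP ->; rewrite msize0.
rewrite (mpolyE f) big_seq.
apply: (big_ind (fun f => exists g, (msize g <= e)%N /\ I (f - g))).
- by exists 0; rewrite msize0 subrr.
- move=> x y [g [gs Ig]] [h [hs Ih]]; exists (g + h); split.
    by rewrite (leq_trans (msizeD_le _ _)) // geq_max gs.
  by rewrite opprD addrACA; apply: ID.
move=> m /msize_mdeg_lt mf.
suff [g [gs Ig]] : exists g, (msize g <= e)%N /\ I ('X_[m] - g).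
  exists (f@_m *: g); split; first exact: leq_trans (msizeZ_le _ _) gs.
  by rewrite -scalerBr -mul_mpolyC; apply: IM.
have [em|me] := leqP e (mdeg m); last first.
  by exists 'X_[m]; rewrite msizeX subrr.
have [h [hs Ih]] := red m em.
have [|g [gs Ig]] := IH h; first by rewrite (leq_trans hs) // -ltnS (leq_trans mf).
exists g; split=> //; rewrite -[X in X - g](subrK h) -addrA; exact: ID.
Qed.

(** The quotient by [I] is spanned by the finitely many monomials of degree below [e], so
    sufficiently many powers of ['X_i] are linearly dependent modulo [I]. *)
Lemma reducible_ideal_zero (K : closedFieldType) (n e : nat)
    (I : {mpoly K[n]} -> Prop) :
    is_ideal I ->
    (forall m, (e <= mdeg m)%N ->
      exists g, (msize g <= mdeg m)%N /\ I ('X_[m] - g)) ->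
  forall i, exists2 p : {poly K}, p != 0 & I (map_poly (@mpolyC n K) p).['X_i].
Proof.
move=> II red i; have [I0 ID IM] := II.
pose B := 'X_{1..n < e}.
have [g gP] := fin_all_exists
  (fun k : 'I_#|{: B}|.+1 => reduce_mod_ideal II red ('X_i ^+ k)).
have [||c [[a ca] sc]] := @linear_dependence K {mpoly K[n]} 'I_#|{: B}|.+1 B
   g (fun m => 'X_[m]) (fun k m => (g k)@_m) _ _.
- by rewrite card_ord.
- by move=> k; rewrite -(mpolywE (gP k).1).
exists (\poly_(k < #|{: B}|.+1) c (inord k)).
  apply/eqP => /polyP/(_ a); rewrite coef_poly coef0 ltn_ord inord_val.
  by apply/eqP.
rewrite poly_def rmorph_sum horner_sum /=.
rewrite -[X in I X]subr0 -[X in _ - X]sc -sumrB; apply: ideal_sum => // k _.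
rewrite map_polyZ map_polyXn hornerZ hornerXn inord_val mul_mpolyC -scalerBr.
by rewrite -mul_mpolyC; apply: IM; case: (gP k).
Qed.

(** * Homogeneous ideals and the projective Nullstellensatz *)

Lemma pihomogM_homog (K : fieldType) (n d e : nat) (g u : {mpoly K[n]}) :
    u \is e.-homog ->
  pihomog mdeg d (g * u) =
    if (e <= d)%N then pihomog mdeg (d - e) g * u else 0.
Proof.
move=> hu; elim/mpolyind: g => [|c m p _ _ IH].
  by rewrite mul0r !pihomog0 mul0r if_same.
rewrite mulrDl -scalerAl !linearD /= !linearZ /= IH pihomogX.
have hm : 'X_[m] * u \is (mdeg m + e).-homog by rewrite dhomogM // dhomogX.
have [ed|de] := leqP e d; last first.
  rewrite (pihomog_ne0 _ hm) ?scaler0 ?addr0 //.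
  by rewrite neq_ltn (leq_trans de) ?orbT // leq_addl.
rewrite mulrDl; congr (_ + _).
have [<-|ne] := eqVneq (mdeg m + e)%N d.
  by rewrite (pihomog_dE hm) addnK eqxx scalerAl.
rewrite (pihomog_ne0 ne hm) ifF ?scaler0 ?mul0r //.
by apply: contraNF ne => /eqP ->; rewrite subnK.
Qed.

Lemma homog_msize_le (K : fieldType) (n d : nat) (f : {mpoly K[n]}) :
  f \is d.-homog -> (msize f <= d.+1)%N.
Proof.
move=> /dhomogP hf; rewrite msizeE.
by apply/bigmax_leqP_seq => m /hf -> _.
Qed.

Definition homogeneous_ideal (K : fieldType) (n : nat) (I : {mpoly K[n]} -> Prop) :=
  is_ideal I /\ forall d f, I f -> I (pihomog mdeg d f).

(** For a homogeneous ideal over an algebraically closed field, this amounts to an empty zero locus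
    in projective space. *)
Definition irrelevant (K : fieldType) (n : nat) (I : {mpoly K[n]} -> Prop) :=
  exists k, forall i, I ('X_i ^+ k).

Lemma adjoin_homogeneous (K : fieldType) (n e : nat) (I : {mpoly K[n]} -> Prop) u :
  homogeneous_ideal I -> u \is e.-homog -> homogeneous_ideal (adjoin I u).
Proof.
move=> [II Ih] hu; split; first exact: adjoin_ideal.
move=> d f [g /(Ih d)]; rewrite linearB /= (pihomogM_homog _ _ hu).
by case: ifP => _ ?; [exists (pihomog mdeg (d - e) g)|exists 0; rewrite mul0r].
Qed.

(* Adjoining the variables one after another, stop just before the zero locus in
   projective space becomes empty: there it is finite. *)
Lemma exists_maximal_cut (K : fieldType) (n : nat) (s : seq 'I_n)
    (I : {mpoly K[n]} -> Prop) :
    homogeneous_ideal I -> ~ irrelevant I ->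
    irrelevant (foldl (fun J i => adjoin J 'X_i) I s) ->
  exists J j, [/\ homogeneous_ideal J, forall f, I f -> J f, ~ irrelevant J
    & irrelevant (adjoin J 'X_j)].
Proof.
elim: s I => [|i s IH] I // hI nI Is.
have hX : ('X_i : {mpoly K[n]}) \is 1.-homog by rewrite dhomogX; apply/eqP/mdeg1.
have [Ii|nIi] := classic (irrelevant (adjoin I 'X_i)); first by exists I, i.
have [J [j [hJ sub nJ Jj]]] := IH _ (adjoin_homogeneous hI hX) nIi Is.
by exists J, j; split=> // f If; apply: sub; apply: sub_adjoin.
Qed.

Lemma large_exponent (n k : nat) (m : 'X_{1..n}) :
  (n * k < mdeg m)%N -> exists i, (k <= m i)%N.
Proof.
move=> h; apply/existsP; apply: contraTT h => /existsPn h.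
rewrite -leqNgt mdegE -[X in (_ <= X * _)%N]card_ord -sum_nat_const.
by apply: leq_sum => i _; apply: ltnW; rewrite ltnNge.
Qed.

Lemma monomial_split (K : fieldType) (n k : nat) (m : 'X_{1..n}) i :
  (k <= m i)%N -> exists m', 'X_[K, m] = 'X_[m'] * 'X_i ^+ k.
Proof.
move=> km; exists (m - U_(i) *+ k)%MM; rewrite mpolyXn -mpolyXD submK //.
apply/mnm_lepP => j; rewrite mulmnE mnm1E; case: eqP => [<-|_]; last by rewrite mul0n.
by rewrite mul1n.
Qed.

Lemma adjoin_expr (R : comNzRingType) (I : R -> Prop) (u f : R) c :
  is_ideal I -> adjoin I u f -> adjoin I (u ^+ c) (f ^+ c).
Proof.
move=> II [g Ig]; exists (g ^+ c); rewrite -exprMn subrXX.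
exact: ideal_mulr.
Qed.

(* Setting [x_j = 1] leaves a proper ideal of finite codimension. *)
Lemma cut_zero (K : closedFieldType) (n : nat) (J : {mpoly K[n]} -> Prop) j :
    homogeneous_ideal J -> ~ irrelevant J -> irrelevant (adjoin J 'X_j) ->
  exists2 v : 'I_n -> K, v j = 1 & forall f, J f -> f.@[v] = 0.
Proof.
move=> [IJ hJ] nJ [k Jk].
have hX : ('X_j : {mpoly K[n]}) \is 1.-homog by rewrite dhomogX; apply/eqP/mdeg1.
have [J0 JD JM] := IJ.
pose C := adjoin J ('X_j - 1).
have IC : is_ideal C by apply: adjoin_ideal.
have C1 : ~ C 1.
  case=> g Jg; apply: nJ.
  (* The homogeneous components of [1 - g * ('X_j - 1)] lie in [J]: they are [1 + g_0] and
     [g_(c+1) - g_c * 'X_j], which gives [g_c = - 'X_j ^+ c] modulo [J] by induction. *)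
  have Jc c : J (pihomog mdeg c g + 'X_j ^+ c).
    elim: c => [|c IHc].
      have := hJ 0 _ Jg; rewrite linearB /= mulrBr mulr1 linearB /=.
      rewrite (pihomogM_homog _ _ hX) /= sub0r opprK.
      by rewrite (pihomog_dE (dhomog1 _ _)) addrC expr0.
    have := hJ c.+1 _ Jg; rewrite linearB /= mulrBr mulr1 linearB /=.
    rewrite (pihomogM_homog _ _ hX) /= subSS subn0.
    rewrite (@pihomog_ne0 _ _ _ 0 c.+1 1) ?dhomog1 // sub0r opprB => Jg'.
    have := JD _ _ Jg' (JM 'X_j _ IHc); congr J.
    by rewrite mulrDr exprS addrA [_ * 'X_j]mulrC subrK.
  (* In this degree the component of [g] is zero, so a power of ['X_j] lies in [J], and then [J] is
     irrelevant. *)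
  pose c := msize g.
  have Jxc : J ('X_j ^+ c).
    have := Jc c; rewrite pihomogE big_seq_cond big1 ?add0r // => m.
    by case/andP=> /msize_mdeg_lt + /eqP cm; rewrite cm ltnn.
  exists (k * c)%N => i; rewrite exprM.
  have [h Jh] := adjoin_expr c IJ (Jk i).
  rewrite -[X in J X](subrK (h * 'X_j ^+ c)).
  by apply: JD => //; apply: JM.
(* A large monomial contains some ['X_i ^+ k], which is a multiple of ['X_j] modulo [J]; setting
   ['X_j] to [1] lowers the degree by one. *)
have redC m : ((n * k).+1 <= mdeg m)%N ->
    exists g, (msize g <= mdeg m)%N /\ C ('X_[m] - g).
  move=> lm; have [i km] := large_exponent lm.
  have [m' mE] := monomial_split K km.
  have [g Jg] := Jk i.
  case mc: (mdeg m) lm => [|c] // _.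
  exists (pihomog mdeg c ('X_[m'] * g)); split.
    exact: homog_msize_le (pihomogP _ _ _).
  exists (pihomog mdeg c ('X_[m'] * g)).
  have := hJ c.+1 _ (JM 'X_[m'] _ Jg).
  rewrite mulrBr -mE mulrA linearB /= (pihomogM_homog _ _ hX) subSS subn0 /=.
  rewrite (pihomog_dE (d := c.+1)); last by rewrite dhomogX; apply/eqP.
  congr J.
  by rewrite mulrBr mulr1 opprB addrA subrK.
have [chi chi0 Cchi] := fin_all_exists2 (reducible_ideal_zero IC redC).
have [v vC] := finite_ideal_zero IC C1 chi0 Cchi.
exists v; last by move=> f Jf; apply: vC; apply: sub_adjoin.
have := vC _ (adjoin_mem ('X_j - 1) IJ).
by rewrite mevalB mevalXU meval1 => /eqP; rewrite subr_eq0 => /eqP.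
Qed.

(** If the ideal of the [F i] were not irrelevant, [cut_zero] would produce a common zero with a
    coordinate equal to [1]. The coefficients become homogeneous on passing to components, and
    [D <= e] keeps [mdeg m - D] exact. *)
Lemma projective_nullstellensatz (K : closedFieldType) (n r D : nat)
    (F : 'I_r -> {mpoly K[n]}) :
    (forall i, F i \is D.-homog) ->
    (forall v : 'I_n -> K, (exists i, v i != 0) -> exists i, (F i).@[v] != 0) ->
  exists2 e, (D <= e)%N & forall m, (e <= mdeg m)%N ->
    exists a : 'I_r -> {mpoly K[n]},
      (forall i, a i \is (mdeg m - D).-homog) /\ 'X_[m] = \sum_i a i * F i.
Proof.
move=> hF nz.
pose I := family_ideal F.
have II : is_ideal I by apply: family_idealP.
have pihE d (a : 'I_r -> {mpoly K[n]}) : (D <= d)%N ->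
    pihomog mdeg d (\sum_i a i * F i) = \sum_i pihomog mdeg (d - D) (a i) * F i.
  move=> Dd; rewrite linear_sum; apply: eq_bigr => i _.
  by rewrite /= (pihomogM_homog _ _ (hF i)) Dd.
have hI : homogeneous_ideal I.
  split=> // d f [a ->]; have [Dd|dD] := leqP D d.
    by rewrite pihE //; exists (fun i => pihomog mdeg (d - D) (a i)).
  rewrite linear_sum big1 /= => [|i _]; first by case: II.
  by rewrite (pihomogM_homog _ _ (hF i)) leqNgt dD.
have [[k Ik]|nI] := classic (irrelevant I); last first.
  have [|J [j [hJ sub nJ Jj]]] := exists_maximal_cut (s := enum 'I_n) hI nI.
    exists 1%N => i; rewrite expr1.
    have: i \in enum 'I_n by rewrite mem_enum.
    have: is_ideal I by [].
    have : i \in enum 'I_n \/ I 'X_i -> is_ideal I ->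
        foldl (fun J i => adjoin J 'X_i) I (enum 'I_n) 'X_i.
      elim: (enum 'I_n) (I) => [|l s IH] L; first by case.
      rewrite inE => h IL /=; apply: IH; last exact: adjoin_ideal.
      case: h => [/orP [/eqP ->|]|Li]; [by right; apply: adjoin_mem|by left|].
      by right; apply: sub_adjoin.
    by move=> H IH hi; apply: H => //; left.
  have [v vj vJ] := cut_zero hJ nJ Jj.
  have [|i] := nz v; first by exists j; rewrite vj oner_eq0.
  by rewrite vJ ?eqxx //; apply: sub; apply: family_ideal_mem.
exists (maxn D (n * k).+1) => [|m]; first exact: leq_maxl.
rewrite geq_max => /andP [Dm km].
have [i ki] := large_exponent km.
have [m' mE] := monomial_split K ki.
have [a aE] : I 'X_[m] by rewrite mE; case: II => _ _; apply.
exists (fun i => pihomog mdeg (mdeg m - D) (a i)); split=> [l|].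
  exact: pihomogP.
by rewrite -pihE // -aE pihomog_dE // dhomogX.
Qed.

(** * Length of the fixed point scheme *)

(* Here [D] is the degree of every [H i], so that [r l] may have degree up to
   [s %/ D]. *)
Definition graded_expansion (K : fieldType) (n D e : nat) (H : 'I_n -> {mpoly K[n]})
    (s : nat) (f : {mpoly K[n]}) :=
  exists r : 'X_{1..n < e} -> {mpoly K[n]},
    (forall l, msize (r l) <= (s %/ D).+1)%N /\
    f = \sum_l subst H (r l) * 'X_[l].

Lemma graded_expansionD (K : fieldType) (n D e : nat)
    (H : 'I_n -> {mpoly K[n]}) s f g :
    graded_expansion D e H s f -> graded_expansion D e H s g ->
  graded_expansion D e H s (f + g).
Proof.
move=> [a [sa ->]] [b [sb ->]]; exists (fun l => a l + b l); split=> [l|].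
  by rewrite (leq_trans (msizeD_le _ _)) // geq_max sa sb.
by rewrite -big_split; apply: eq_bigr => l _; rewrite rmorphD mulrDl.
Qed.

Lemma graded_expansion_sum (K : fieldType) (n D e : nat)
    (H : 'I_n -> {mpoly K[n]}) s (T : Type) (r : seq T) (P : pred T) F :
    (forall i, P i -> graded_expansion D e H s (F i)) ->
  graded_expansion D e H s (\sum_(i <- r | P i) F i).
Proof.
move=> hF; apply: (big_ind (graded_expansion D e H s)) => //.
  exists (fun=> 0); split=> [l|]; first by rewrite msize0.
  by rewrite big1 // => l _; rewrite rmorph0 mul0r.
exact: graded_expansionD.
Qed.

Lemma graded_expansionZ (K : fieldType) (n D e : nat)
    (H : 'I_n -> {mpoly K[n]}) s c f :
  graded_expansion D e H s f -> graded_expansion D e H s (c *: f).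
Proof.
move=> [a [sa ->]]; exists (fun l => c *: a l); split=> [l|].
  exact: leq_trans (msizeZ_le _ _) (sa l).
by rewrite scaler_sumr; apply: eq_bigr => l _; rewrite substZ scalerAl.
Qed.

Lemma graded_expansion_le (K : fieldType) (n D e : nat)
    (H : 'I_n -> {mpoly K[n]}) s t f :
  (s <= t)%N -> graded_expansion D e H s f -> graded_expansion D e H t f.
Proof.
move=> st [a [sa ->]]; exists a; split=> // l.
by rewrite (leq_trans (sa l)) // ltnS leq_div2r.
Qed.

(** The new factor ['X_i] raises the degree of the coefficients by one, in step with
    [(s + D) %/ D = s %/ D + 1]. *)
Lemma graded_expansionMH (K : fieldType) (n D e : nat)
    (H : 'I_n -> {mpoly K[n]}) s f i : (0 < D)%N ->
  graded_expansion D e H s f -> graded_expansion D e H (s + D) (f * H i).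
Proof.
move=> D0 [a [sa ->]]; exists (fun l => a l * 'X_i); split=> [l|].
  have [->|al] := eqVneq (a l) 0; first by rewrite mul0r msize0.
  have X0 : 'X_i != 0 :> {mpoly K[n]} by rewrite -msize_poly_eq0 msizeX.
  rewrite msizeM // msizeX mdeg1 addn2 /= divnDr // divnn D0 addn1.
  by rewrite ltnS.
rewrite mulr_suml; apply: eq_bigr => l _.
by rewrite rmorphM /= substXU mulrAC.
Qed.

(** In ['X_[m] = \sum_i a i * G i] write [G i] as [(G i - 'X_i) + 'X_i]. As [1 < D], both [a i] and
    [a i * 'X_i] have degree below [mdeg m], and each factor [G i - 'X_i] uses up [D] degrees. *)
Lemma graded_expansionP (K : fieldType) (n D e : nat) (G : 'I_n -> {mpoly K[n]}) :
    (1 < D)%N -> (D <= e)%N ->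
    (forall m, (e <= mdeg m)%N -> exists a : 'I_n -> {mpoly K[n]},
      (forall i, a i \is (mdeg m - D).-homog) /\ 'X_[m] = \sum_i a i * G i) ->
  forall s f, (msize f <= s.+1)%N ->
    graded_expansion D e (fun i => G i - 'X_i) s f.
Proof.
move=> D1 De red; elim/ltn_ind => s IH f fs.
rewrite (mpolyE f) big_seq; apply: graded_expansion_sum => m mf.
apply: graded_expansionZ.
have ms : (mdeg m <= s)%N by rewrite -ltnS (leq_trans (msize_mdeg_lt mf)).
have [me|em] := ltnP (mdeg m) e.
  exists (fun l => (l == BMultinom me)%:R); split=> [l|].
    by case: eqP => _; rewrite ?msize1 ?msize0.
  rewrite (bigD1 (BMultinom me)) //= eqxx rmorph1 mul1r big1 ?addr0 //.
  by move=> l /negPf ->; rewrite rmorph0 mul0r.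
have [a [ha ->]] := red m em.
have aE i : a i * G i = a i * (G i - 'X_i) + a i * 'X_i.
  by rewrite mulrBr subrK.
under eq_bigr do rewrite aE.
have sa i : (msize (a i) <= (s - D).+1)%N.
  by apply: leq_trans (homog_msize_le (ha i)) _; rewrite ltnS leq_sub2r.
have Ds : (D <= s)%N by apply: leq_trans ms; apply: leq_trans em.
rewrite big_split /=; apply: graded_expansionD.
  apply: graded_expansion_sum => i _; rewrite -{1}(subnK Ds).
  apply: graded_expansionMH; first exact: ltnW.
  apply: IH (sa i); clear -D1 Ds; lia.
apply: graded_expansion_sum => i _.
apply: (@graded_expansion_le _ _ _ _ _ s.-1); first exact: leq_pred.
apply: IH; first by clear -D1 Ds; lia.
have [->|ai] := eqVneq (a i) 0; first by rewrite mul0r msize0.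
have X0 : 'X_i != 0 :> {mpoly K[n]} by rewrite -msize_poly_eq0 msizeX.
rewrite msizeM // msizeX mdeg1 addn2 /= (leq_ltn_trans (sa i)) //; lia.
Qed.

Lemma card_bmultinom_le (n v : nat) : (#|{: 'X_{1..n < v}}| <= v ^ n)%N.
Proof.
have lt (m : 'X_{1..n < v}) i : (m i < v)%N.
  apply: leq_ltn_trans (bmdeg m); rewrite mdegE (bigD1 i) //=; exact: leq_addr.
pose h (m : 'X_{1..n < v}) : {ffun 'I_n -> 'I_v} := [ffun i => Ordinal (lt m i)].
have hI : injective h.
  move=> m m' /ffunP hm; apply: val_inj; apply/mnmP => i.
  by have := hm i; rewrite !ffunE => -[].
by have := leq_card h hI; rewrite card_ffun !card_ord.
Qed.

(* Nakayama's lemma with an explicit denominator: the monomials [l] satisfy a linear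
   system with matrix [1 - P (H)], where [P] vanishes at [0], modulo the span of
   the [w j], and [delta = det (1 - P)]. *)
Lemma expansion_determinant (K : fieldType) (n D e : nat) (H : 'I_n -> {mpoly K[n]})
    (J : finType) (ell : J -> {mpoly K[n]} -> K) :
    (forall s f, (msize f <= s.+1)%N -> graded_expansion D e H s f) ->
    (forall j c f g, ell j (c *: f + g) = c * ell j f + ell j g) ->
    (forall f, (forall j, ell j f = 0) -> family_ideal H f) ->
  exists (rho : nat) (delta : {mpoly K[n]}) (w : 'I_rho -> {mpoly K[n]})
      (t : 'X_{1..n < e} -> 'I_rho -> {mpoly K[n]}),
    [/\ (rho <= #|J|)%N, delta.@[fun=> 0] = 1
      & forall l : 'X_{1..n < e},
          subst H delta * 'X_[l] = \sum_j subst H (t l j) * w j].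
Proof.
move=> gen lin kerH.
have lin0 j : ell j 0 = 0.
  by rewrite -[X in ell _ X](addr0 0) -{1}(scaler0 _ (-1)) lin mulN1r addNr.
have lin_sum j (T : finType) (c : T -> K) (F : T -> {mpoly K[n]}) :
    ell j (\sum_i c i *: F i) = \sum_i c i * ell j (F i).
  by apply: (big_rec2 (fun x y => ell j x = y)) => [|i y x _ <-].
have linB j f g : ell j (f - g) = ell j f - ell j g.
  by rewrite addrC -scaleN1r lin mulN1r addrC.
pose B := 'X_{1..n < e}; pose M := #|{: B}|.
pose f (l : 'I_M) : {mpoly K[n]} := 'X_[enum_val l].
(* Row [l] holds the values of all functionals on the monomial [f l]; the rank of [W] will be
   [rho]. *)
pose W := \matrix_(l < M, j < #|J|) ell (enum_val j) (f l).
have [E RE] : exists E, row_base W = E *m W.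
  by apply/submxP; rewrite eq_row_base.
have [C WC] : exists C, W = C *m row_base W.
  by apply/submxP; rewrite eq_row_base.
have [Q QE] : exists Q, Q = C *m E by exists (C *m E).
have WQ : W = Q *m W by rewrite QE {1}WC {1}RE mulmxA.
(* [Q] fixes [W] and factors through a space of dimension [\rank W], so these differences are killed
   by every functional. *)
have kerg l : exists a : 'I_n -> {mpoly K[n]},
    f l - \sum_k Q l k *: f k = \sum_i a i * H i.
  apply: kerH => j; rewrite linB lin_sum -(enum_rankK j).
  have := congr1 (fun X : 'M_(_, _) => X l (enum_rank j)) WQ.
  rewrite !mxE => {1}->; apply/eqP; rewrite subr_eq0; apply/eqP.
  by apply: eq_bigr => k _; rewrite [W _ _]mxE.
have [a aE] := fin_all_exists kerg.
have [r rE] := fin_all_exists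
  (fun li : 'I_M * 'I_n => gen _ (a li.1 li.2) (leqnSn _)).
pose P : 'M[{mpoly K[n]}]_M := \matrix_(l, k) \sum_i r (l, i) (enum_val k) * 'X_i.
pose A := 1%:M - P.
pose fv : 'cV[{mpoly K[n]}]_M := \col_l f l.
pose mC := map_mx (@mpolyC n K).
have Afv : map_mx (subst H) A *m fv = mC _ _ Q *m fv.
  apply/colP => l; rewrite map_mxB map_mx1 mulmxBl mul1mx.
  have := aE l; move/eqP; rewrite subr_eq addrC -subr_eq => /eqP.
  rewrite !mxE => hl.
  under [RHS]eq_bigr do rewrite !mxE mul_mpolyC.
  rewrite -hl; congr (_ - _).
  transitivity (\sum_i \sum_k subst H (r (l, i) (enum_val k)) * f k * H i).
    rewrite exchange_big; apply: eq_bigr => k _; rewrite !mxE raddf_sum.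
    rewrite mulr_suml; apply: eq_bigr => i _.
    by rewrite /= rmorphM /= substXU mulrAC.
  apply: eq_bigr => i _; rewrite -mulr_suml; congr (_ * _).
  rewrite [RHS](rE (l, i)).2 (reindex (@enum_val B xpredT)) //=.
  by exists enum_rank => x _; rewrite ?enum_valK ?enum_rankK.
(* Multiplying [A(H) f = Q f = C E f] by the adjugate of [A(H)] leaves [delta(H) f] on the left,
   with [w = E f] on the right. *)
exists (\rank W), (\det A), (fun j => (mC _ _ E *m fv) j 0).
exists (fun l j => (\adj A *m mC _ _ C) (enum_rank l) j); split.
- exact: rank_leq_col.
- rewrite -det_map_mx map_mxB map_mx1 [X in _ - X](_ : _ = 0) ?subr0 ?det1 //.
  apply/matrixP => l k; rewrite !mxE raddf_sum big1 //= => i _.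
  by rewrite mevalM mevalXU mulr0.
move=> l; set l' := enum_rank l.
have -> : 'X_[l] = fv l' 0 by rewrite mxE /f enum_rankK.
rewrite -det_map_mx.
transitivity ((map_mx (subst H) (\adj A *m mC _ _ C) *m (mC _ _ E *m fv)) l' 0).
  rewrite map_mxM (_ : map_mx _ (mC _ _ C) = mC _ _ C); last first.
    by apply/matrixP => i j; rewrite !mxE /= substC.
  rewrite mulmxA -(mulmxA _ (mC _ _ C)) -map_mxM -QE -mulmxA -Afv mulmxA map_mx_adj.
  by rewrite mul_adj_mx mul_scalar_mx [RHS]mxE.
by rewrite mxE; apply: eq_bigr => j _; rewrite mxE.
Qed.

(* Multiplication by [subst H delta] embeds the span of the monomials with exponents
   below [D * u] into the span of the [H ^ m * w j] with [mdeg m < v], where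
   [v <= 2 * n * u]. *)
Lemma degree_count (K : fieldType) (n D e : nat) (H : 'I_n -> {mpoly K[n]})
    (J : finType) (ell : J -> {mpoly K[n]} -> K) :
    (0 < n)%N -> (0 < D)%N -> (forall i, (H i).@[fun=> 0] = 0) ->
    (forall s f, (msize f <= s.+1)%N -> graded_expansion D e H s f) ->
    (forall j c f g, ell j (c *: f + g) = c * ell j f + ell j g) ->
    (forall f, (forall j, ell j f = 0) -> family_ideal H f) ->
  (D ^ n <= #|J| * (2 * n) ^ n)%N.
Proof.
move=> n0 D0 H0 gen lin kerH.
have [rho [delta [w [t [rhoJ delta0 wt]]]]] := expansion_determinant gen lin kerH.
pose tau := \max_l \max_j msize (t l j).
(* Products of factors with [msize] at most [(n * u).+1] and [tau] must have [msize] at most [v];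
   [tau.+2] leaves that room. *)
pose u := tau.+2; pose v := (n * u + u)%N.
pose A := {ffun 'I_n -> 'I_(D * u)}.
pose mon (b : A) : 'X_{1..n} := [multinom val (b i) | i < n].
pose d := subst H delta.
(* [H] vanishes at the origin, so [d] takes there the value of [delta] at [0], which is [1]. *)
have d0 : d != 0.
  apply: contra_eq_neq delta0 => /(congr1 (meval (fun=> 0))).
  rewrite meval_subst meval0 (meval_eq (v2 := fun=> 0)) // => ->.
  by rewrite eq_sym oner_eq0.
have expand (b : A) : exists c : 'I_rho * 'X_{1..n < v} -> K,
    d * 'X_[mon b] = \sum_jm c jm *: (subst H 'X_[jm.2] * w jm.1).
  have sb : (msize ('X_[mon b] : {mpoly K[n]}) <= (D * (n * u)).+1)%N.
    rewrite msizeX ltnS mdegE -[X in (_ <= D * (X * _))%N]card_ord.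
    rewrite mulnCA -sum_nat_const; apply: leq_sum => i _.
    by rewrite mnmE; apply: ltnW (ltn_ord _).
  have [r [rs ->]] := gen _ _ sb.
  pose c j := \sum_l r l * t l j.
  have cs j : (msize (c j) <= v)%N.
    apply: leq_trans (msize_sum _ _ _) _; apply/bigmax_leqP => l _.
    apply: leq_trans (msizeM_le _ _) _.
    have := rs l; rewrite mulKn // => rl.
    have tl : (msize (t l j) <= tau)%N.
      apply: leq_trans (leq_bigmax l); exact: (leq_bigmax j).
    by rewrite (leq_ltn_trans (leq_add rl tl)) // /v /u addSn !addnS.
  exists (fun jm : 'I_rho * 'X_{1..n < v} => (c jm.1)@_jm.2).
  rewrite mulr_sumr; under eq_bigr do rewrite mulrCA wt mulr_sumr.
  rewrite exchange_big -(pair_bigA _ (fun j (m : 'X_{1..n < v}) =>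
    (c j)@_m *: (subst H 'X_[m] * w j))) /=.
  apply: eq_bigr => j _.
  under eq_bigr do rewrite mulrA -rmorphM /=.
  rewrite -mulr_suml -rmorph_sum /= -/(c j) {1}(mpolywE (cs j)) rmorph_sum mulr_suml.
  by apply: eq_bigr => m _; rewrite /= substZ scalerAl.
have [C CE] := fin_all_exists expand.
have [lt|le] := ltnP #|{: 'I_rho * 'X_{1..n < v}}| #|A|.
  (* Cancelling [d] from the relation makes distinct monomials dependent. *)
  have [c [[b cb] sc]] := linear_dependence lt CE.
  have: d * \sum_b c b *: 'X_[mon b] = 0.
    by rewrite mulr_sumr -[RHS]sc; apply: eq_bigr => i _; rewrite scalerAr.
  move/eqP; rewrite mulf_eq0 (negPf d0) /= => /eqP/(congr1 (mcoeff (mon b))).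
  rewrite mcoeff0 raddf_sum (bigD1 b) //= mcoeffZ mcoeffX eqxx mulr1 big1.
    by rewrite addr0 => cb0; rewrite cb0 eqxx in cb.
  move=> i ib; rewrite mcoeffZ mcoeffX [_ == _](_ : _ = false) ?mulr0 //.
  apply: contraNF ib => /eqP/mnmP mi; apply/eqP/ffunP => j; apply: val_inj.
  by have := mi j; rewrite !mnmE.
have: ((D * u) ^ n <= #|J| * (2 * n * u) ^ n)%N.
  have -> : ((D * u) ^ n = #|A|)%N by rewrite card_ffun !card_ord.
  apply: leq_trans le _; rewrite card_prod card_ord leq_mul //.
  apply: leq_trans (card_bmultinom_le _ _) _; rewrite leq_exp2r // /v.
  by rewrite -mulnA mul2n -addnn leq_add2l leq_pmull.
by rewrite !expnMn mulnA leq_pmul2r // expn_gt0.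
Qed.

(** * Iterates and multiplicities *)

Definition eval_map (K : fieldType) (n : nat) (F : 'I_n -> {mpoly K[n]})
    (v : 'I_n -> K) : 'I_n -> K :=
  fun i => (F i).@[v].

Definition iter_map (K : fieldType) (n : nat) (F : 'I_n -> {mpoly K[n]}) (s : nat) :
    'I_n -> {mpoly K[n]} :=
  iter s (fun G i => subst G (F i)) (fun i => 'X_i).

Lemma eval_iter_map (K : fieldType) (n : nat) (F : 'I_n -> {mpoly K[n]}) s v i :
  (iter_map F s i).@[v] = iter s (eval_map F) v i.
Proof.
elim: s i => [|s IH] i; first by rewrite mevalXU.
by rewrite /iter_map iterS meval_subst iterS; apply: meval_eq.
Qed.

Lemma eval_iter_fixed (K : fieldType) (n : nat) (F : 'I_n -> {mpoly K[n]}) v :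
    eval_map F v =1 v ->
  forall s i, (iter_map F s i).@[v] = v i.
Proof.
move=> Fv s i; rewrite eval_iter_map; elim: s i => // s IH i.
by rewrite iterS -[RHS]Fv; apply: meval_eq.
Qed.

Lemma subst_homog (K : fieldType) (n d D : nat) (G : 'I_n -> {mpoly K[n]}) f :
    (forall i, G i \is D.-homog) -> f \is d.-homog ->
  subst G f \is (d * D).-homog.
Proof.
move=> hG /dhomogP hf; rewrite (mpolyE f) big_seq rmorph_sum /=.
apply: rpred_sum => m /hf md; rewrite substZ; apply: rpredZ.
have {}md : (d = \sum_i m i)%N by rewrite -md; apply: mdegE.
rewrite substX md big_distrl /=.
apply: (big_rec2 (fun p s => p \is s.-homog)) => [|i s p _ hp].
  exact: dhomog1.
by rewrite dhomogM // mulnC; apply: dhomogMn.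
Qed.

Lemma iter_map_homog (K : fieldType) (n d : nat) (F : 'I_n -> {mpoly K[n]}) :
    (forall i, F i \is d.-homog) ->
  forall s i, iter_map F s i \is (d ^ s).-homog.
Proof.
move=> hF; elim=> [|s IH] i; first by rewrite dhomogX; apply/eqP/mdeg1.
by rewrite /iter_map iterS expnS; apply: subst_homog.
Qed.

Lemma iter_map_nonzero (K : fieldType) (n : nat) (F : 'I_n -> {mpoly K[n]}) :
    (forall v : 'I_n -> K, (exists i, v i != 0) -> exists i, (F i).@[v] != 0) ->
  forall s v, (exists i, v i != 0) -> exists i, (iter_map F s i).@[v] != 0.
Proof.
move=> nz s v v0; elim: s => [|s [i hi]].
  by case: v0 => i vi; exists i; rewrite mevalXU.
have [|j hj] := nz (fun i => (iter_map F s i).@[v]); first by exists i.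
by exists j; rewrite /iter_map iterS meval_subst.
Qed.

Lemma subst_scale_homog (K : fieldType) (n D : nat) (c : K) (f : {mpoly K[n]}) :
  f \is D.-homog -> subst (fun i => c *: 'X_i) f = c ^+ D *: f.
Proof.
move=> /dhomogP hf; rewrite {1 2}(mpolyE f) rmorph_sum scaler_sumr big_seq [RHS]big_seq.
apply: eq_bigr => m /hf md; rewrite /= substZ !scalerA mulrC -scalerA; congr (_ *: _).
have {}md : (D = \sum_i m i)%N by rewrite -md; apply: mdegE.
rewrite substX mpolyXE_id md; under eq_bigr do rewrite exprZn.
by rewrite scaler_prod prodrXr.
Qed.

Lemma meval_scale_homog (K : fieldType) (n D : nat) (c : K) (f : {mpoly K[n]}) v :
  f \is D.-homog -> f.@[fun i => c * v i] = c ^+ D * f.@[v].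
Proof.
move=> hf; rewrite -mevalZ -(subst_scale_homog c hf) meval_subst.
by apply: meval_eq => i; rewrite mevalZ mevalXU.
Qed.

(* The successive differences satisfy
   [F^(s+2) - F^(s+1) = Q_s (F^(s+1) - F^s)], where [Q_s] takes the same value [A] at
   the fixed point for all [s]. *)
Lemma iter_difference (K : fieldType) (N : nat) (F : 'I_N.+1 -> {mpoly K[N.+1]}) v :
    eval_map F v =1 v ->
  exists A : 'M[K]_N.+1, forall q, exists B : 'M[{mpoly K[N.+1]}]_N.+1,
    map_mx (meval v) B = \sum_(s < q) A ^+ s /\
    forall i, iter_map F q i - 'X_i = \sum_j B i j * (F j - 'X_j).
Proof.
move=> Fv.
have [a aP] := fin_all_exists (fun i => divided_difference v v (F i)).
exists (\matrix_(i, j) a i j); set A := \matrix_(i, j) _.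
have step s : exists C : 'M[{mpoly K[N.+1]}]_N.+1, map_mx (meval v) C = A ^+ s /\
    forall i, iter_map F s.+1 i - iter_map F s i = \sum_j C i j * (F j - 'X_j).
  elim: s => [|s [C [Cv CE]]].
    exists 1%:M; rewrite map_mx1 expr0; split=> // i.
    rewrite /iter_map /= subst_id (bigD1 i) //= mxE eqxx mul1r big1 ?addr0 //.
    by move=> j ji; rewrite mxE eq_sym (negPf ji) mul0r.
  have [Q QP] := fin_all_exists (fun i => aP i _ _
    (eval_iter_fixed Fv s.+1) (eval_iter_fixed Fv s)).
  exists ((\matrix_(i, j) Q i j) *m C); split=> [|i].
    rewrite map_mxM Cv exprS; congr (_ *m _); apply/matrixP => i j.
    by rewrite !mxE; apply: (QP i).1.
  rewrite [LHS](QP i).2; under eq_bigr do rewrite CE mulr_sumr.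
  rewrite exchange_big; apply: eq_bigr => j _; rewrite mxE mulr_suml.
  by apply: eq_bigr => l _; rewrite mxE mulrA.
elim=> [|q [B [Bv BE]]].
  exists 0; rewrite big_ord0 map_mx0; split=> // i.
  by rewrite subrr big1 // => j _; rewrite mxE mul0r.
have [C [Cv CE]] := step q.
exists (B + C); rewrite map_mxD Bv Cv big_ord_recr; split=> // i.
rewrite -(subrKA (iter_map F q i)) CE BE addrC -big_split.
by apply: eq_bigr => j _; rewrite mxE mulrDl.
Qed.

Lemma uniform_bound (T : eqType) (s : seq T) (P : T -> nat -> Prop) :
    (forall x, x \in s -> exists M, forall q, (M < q)%N -> P x q) ->
  exists M, forall x, x \in s -> forall q, (M < q)%N -> P x q.
Proof.
elim: s => [|x s IH] h; first by exists 0%N.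
have [|M hM] := IH; first by move=> y ys; apply: h; rewrite inE ys orbT.
have [|M' hM'] := h x; first by rewrite inE eqxx.
exists (maxn M M') => y; rewrite inE => /orP [/eqP ->|ys] q; rewrite gtn_max.
  by case/andP=> _; apply: hM'.
by case/andP=> ? _; apply: hM.
Qed.

(* Two distinct primes [q] cannot both make the sum vanish: [z] would be [1], and both
   primes would vanish in [K]. *)
Lemma geometric_sum_neq0 (K : fieldType) (z : K) :
  exists M, forall q, (M < q)%N -> prime q -> \sum_(s < q) z ^+ s != 0.
Proof.
have [[q0 [pq0 hq0]]|none] := classic (exists q, prime q /\ \sum_(s < q) z ^+ s = 0);
  last by exists 0%N => q _ pq; apply/eqP => h; apply: none; exists q.
exists q0 => q ltq pq; apply/eqP => hq.
have cop : coprime q q0.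
  by rewrite prime_coprime // dvdn_prime2 // gtn_eqF.
have pow r : \sum_(s < r) z ^+ s = 0 -> z ^+ r = 1.
  by move=> h; apply/eqP; rewrite -subr_eq0 subrX1 h mulr0.
have [[u w] /= uw] : exists uw : nat * nat, (uw.1 * q = uw.2 * q0 + 1)%N.
  have := egcdnP q0 (prime_gt0 pq); case=> u w /= e _.
  by exists (u, w); rewrite e /=; move: cop; rewrite /coprime => /eqP ->.
have z1 : z = 1.
  have := congr1 (fun k => z ^+ k) uw; rewrite exprD !(mulnC _ q) !(mulnC _ q0).
  by rewrite !exprM (pow _ hq) (pow _ hq0) !expr1n expr1 mul1r.
have nat0 r : \sum_(s < r) z ^+ s = 0 -> r%:R = 0 :> K.
  move=> <-; rewrite z1; under eq_bigr do rewrite expr1n.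
  by rewrite sumr_const card_ord.
have := congr1 (fun k => k%:R : K) uw; rewrite natrD !natrM (nat0 _ hq) (nat0 _ hq0).
by rewrite !mulr0 add0r => /esym/eqP; rewrite oner_eq0.
Qed.

(** The matrix is [p(A)] with [p = 1 + X + ... + X^(q-1)]. Splitting [p] into linear factors, a zero
    determinant makes some root of [p] an eigenvalue of [A]; [geometric_sum_neq0] excludes this for
    each of the finitely many eigenvalues. *)
Lemma det_power_sum_neq0 (K : closedFieldType) (N : nat) (A : 'M[K]_N.+1) :
  exists M, forall q, (M < q)%N -> prime q -> \det (\sum_(s < q) A ^+ s) != 0.
Proof.
have [rs chiE] := closed_field_poly_normal (char_poly A).
have [|M hM] := @uniform_bound _ rs
  (fun z q => prime q -> \sum_(s < q) z ^+ s != 0).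
  by move=> z _; apply: geometric_sum_neq0.
exists M => q ltq pq; pose p : {poly K} := \poly_(s < q) 1.
have -> : \sum_(s < q) A ^+ s = horner_mx A p.
  rewrite /p poly_def rmorph_sum; apply: eq_bigr => s _.
  by rewrite scale1r rmorphXn /= horner_mx_X.
have [ts pE] := closed_field_poly_normal p.
have p0 : p != 0.
  apply/eqP => /polyP/(_ 0%N); rewrite coef_poly prime_gt0 // coef0.
  by apply/eqP; rewrite oner_eq0.
rewrite pE linearZ /= detZ mulf_neq0 ?expf_neq0 ?lead_coef_eq0 //.
rewrite rmorph_prod /= (big_morph _ (@det_mulmx _ _) (@det1 _ _)).
rewrite prodf_seq_neq0; apply/allP => z zt; apply/implyP => _.
rewrite rmorphB /= horner_mx_X horner_mx_C; apply/negP => detz.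
have zr : z \in rs.
  have: root (char_poly A) z.
    rewrite -eigenvalue_root_char; apply/eigenvalueP.
    have [u u0 uz] := det0P detz; exists u => //.
    by move: uz; rewrite mulmxBr mul_mx_scalar => /eqP; rewrite subr_eq0 => /eqP.
  rewrite chiE rootZ ?root_prod_XsubC // lead_coef_eq0.
  exact/monic_neq0/char_poly_monic.
have := hM z zr q ltq pq; apply/negP; rewrite negbK.
have: root p z by rewrite pE rootZ ?root_prod_XsubC // lead_coef_eq0.
rewrite /root /p horner_poly; congr (_ == _).
by apply: eq_bigr => s _; rewrite mul1r.
Qed.

(** * Local tests for membership in an ideal *)

(** Every monomial surviving in the Taylor expansion of [f] at [y] has some exponent at least [k],
    hence a factor that [h] carries into [I]. Thus [k ^ n] linear conditions suffice near [y]. *)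
Lemma shift_kernel (K : fieldType) (n k : nat) (I : {mpoly K[n]} -> Prop)
    (y : 'I_n -> K) h f :
    is_ideal I -> (forall i, I (h * ('X_i - (y i)%:MP) ^+ k)) ->
    (forall a : {ffun 'I_n -> 'I_k},
      (subst (fun i => 'X_i + (y i)%:MP) f)@_[multinom val (a i) | i < n] = 0) ->
  I (h * f).
Proof.
move=> II Ih; set g := subst _ f => g0.
have -> : f = subst (fun i => 'X_i - (y i)%:MP) g.
  rewrite subst_comp -[LHS]subst_id; apply: eq_subst => i.
  by rewrite rmorphD /= substXU substC subrK.
rewrite (mpolyE g) rmorph_sum mulr_sumr big_seq; apply: ideal_sum => // m mg.
rewrite /= substZ -mul_mpolyC mulrCA; case: (II) => _ _; apply.
have [i ki] : exists i, (k <= m i)%N.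
  apply/existsP; apply: contraLR mg => /existsPn lt.
  rewrite -mcoeff_eq0; apply/eqP.
  have ltk i : (m i < k)%N by rewrite ltnNge.
  rewrite -(g0 [ffun i => Ordinal (ltk i)]); congr (_ @_ _).
  by apply/mnmP => i; rewrite mnmE ffunE.
rewrite substX (bigD1 i) //= -(subnKC ki) exprD !mulrA.
by do 2!apply: ideal_mulr => //.
Qed.

(* The colon ideal [(I : f)] contains [I] and has no zero. *)
Lemma local_membership (K : closedFieldType) (n e : nat) (I : {mpoly K[n]} -> Prop) f :
    is_ideal I ->
    (forall m, (e <= mdeg m)%N ->
      exists g, (msize g <= mdeg m)%N /\ I ('X_[m] - g)) ->
    (forall v, (forall g, I g -> g.@[v] = 0) ->
      exists2 h, h.@[v] != 0 & I (h * f)) ->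
  I f.
Proof.
move=> II red loc; pose C g := I (g * f).
have [I0 ID IM] := II.
have IC : is_ideal C.
  split; first by rewrite /C mul0r.
  - by move=> a b Ca Cb; rewrite /C mulrDl; apply: ID.
  - by move=> a b Cb; rewrite /C -mulrA; apply: IM.
have sub g : I g -> C g by move=> Ig; apply: ideal_mulr.
have [|C1] := classic (C 1); first by rewrite /C mul1r.
have redC m : (e <= mdeg m)%N -> exists g, (msize g <= mdeg m)%N /\ C ('X_[m] - g).
  by case/red=> g [gs Ig]; exists g; split=> //; apply: sub.
have [chi chi0 Cchi] := fin_all_exists2 (reducible_ideal_zero IC redC).
have [v vC] := finite_ideal_zero IC C1 chi0 Cchi.
have [|h hv Ch] := loc v; first by move=> g /sub; apply: vC.
by rewrite (vC _ Ch) eqxx in hv.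
Qed.

(** Modulo the ideal, [G i] may be replaced by ['X_i] in the Nullstellensatz identity, and this
    lowers the degree because [1 < D]. *)
Lemma fixed_ideal_reduction (K : closedFieldType) (n D : nat)
    (G : 'I_n -> {mpoly K[n]}) :
    (1 < D)%N -> (forall i, G i \is D.-homog) ->
    (forall v : 'I_n -> K, (exists i, v i != 0) -> exists i, (G i).@[v] != 0) ->
  exists e, (forall s f, (msize f <= s.+1)%N ->
      graded_expansion D e (fun i => G i - 'X_i) s f) /\
    (forall m, (e <= mdeg m)%N -> exists g, (msize g <= mdeg m)%N /\
      family_ideal (fun i => G i - 'X_i) ('X_[m] - g)).
Proof.
move=> D1 hG nz; have [e De red] := projective_nullstellensatz hG nz.
exists e; split; first exact: graded_expansionP.
move=> m em; have [a [ha aE]] := red m em.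
exists (\sum_i a i * 'X_i); split; last first.
  by exists a; rewrite aE -sumrB; apply: eq_bigr => i _; rewrite mulrBr.
apply: leq_trans (msize_sum _ _ _) _; apply/bigmax_leqP => i _.
have hX : ('X_i : {mpoly K[n]}) \is 1.-homog by rewrite dhomogX; apply/eqP/mdeg1.
apply: leq_trans (homog_msize_le (dhomogM (ha i) hX)) _.
have := leq_trans De em; clear -D1; lia.
Qed.

Lemma meval_univariate (K : fieldType) (n : nat) (p : {poly K}) (v : 'I_n -> K) i :
  (map_poly (@mpolyC n K) p).['X_i].@[v] = p.[v i].
Proof.
rewrite -horner_map /= mevalXU -map_poly_comp map_poly_id // => x _.
exact: mevalC.
Qed.

(** Split off from each [chi i] the full power of ['X - v i]; [h] is the product of the cofactors,
    evaluated at the variables. The exponent is uniform in [v]. *)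
Lemma fixed_point_multiplicity (K : closedFieldType) (n : nat)
    (I : {mpoly K[n]} -> Prop) (chi : 'I_n -> {poly K}) v :
    is_ideal I -> (forall i, chi i != 0) ->
    (forall i, I (map_poly (@mpolyC n K) (chi i)).['X_i]) ->
  exists2 h, h.@[v] != 0 &
    forall i, I (h * ('X_i - (v i)%:MP) ^+ \max_j size (chi j)).
Proof.
move=> II chi0 Ichi; set k := \max_j _.
have factor i : exists2 p : {poly K}, ~~ root p (v i) &
    exists2 l, (l <= k)%N & chi i = p * ('X - (v i)%:P) ^+ l.
  have [l [p]] := multiplicity_XsubC (chi i) (v i).
  rewrite chi0 /= => pv chiE; exists p => //; exists l => //.
  apply: leq_trans (leq_bigmax i); rewrite chiE size_Mmonic ?monic_exp ?monicXsubC //.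
    by rewrite size_exp_XsubC addnS leq_addl.
  by apply: contraNneq pv => ->; rewrite root0.
have [p pv pE] := fin_all_exists2 factor.
pose P i := (map_poly (@mpolyC n K) (p i)).['X_i].
exists (\prod_i P i) => [|i].
  rewrite rmorph_prod prodf_seq_neq0; apply/allP => i _; apply/implyP => _.
  by rewrite /= meval_univariate; apply: pv.
rewrite (bigD1 i) //= mulrAC; apply: ideal_mulr => //.
have [l lk chiE] := pE i.
have := Ichi i; rewrite chiE rmorphM rmorphXn /= map_polyXsubC hornerM horner_exp.
rewrite hornerXsubC -(subnKC lk) exprD mulrA; exact: ideal_mulr.
Qed.

(** Each coordinate of a zero is a root of [chi i], and [a] picks an index in each list of roots.
    Such a list is shorter than [size (chi i)]; spare indices return the default [0], and some [z a]
    need not be zeros. *)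
Lemma zero_coordinate_mem (K : closedFieldType) (n : nat)
    (I : {mpoly K[n]} -> Prop) (chi : 'I_n -> {poly K}) :
    (forall i, chi i != 0) ->
    (forall i, I (map_poly (@mpolyC n K) (chi i)).['X_i]) ->
  exists z : {ffun 'I_n -> 'I_(\max_j size (chi j))} -> 'I_n -> K,
    forall v, (forall f, I f -> f.@[v] = 0) -> exists a, v =1 z a.
Proof.
move=> chi0 Ichi; set k := \max_j _.
have [rs rsE] := fin_all_exists (fun i =>
  let: exist r rE := closed_field_poly_normal (chi i) in ex_intro _ r rE).
exists (fun (a : {ffun 'I_n -> 'I_k}) i => nth 0 (rs i) (a i)) => v vI.
have mem i : v i \in rs i.
  have := vI _ (Ichi i); rewrite meval_univariate => /rootP.
  by rewrite rsE rootZ ?root_prod_XsubC // lead_coef_eq0.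
have lt i : (index (v i) (rs i) < k)%N.
  apply: leq_trans (leq_bigmax i); rewrite rsE size_scale ?lead_coef_eq0 //.
  by rewrite size_prod_XsubC ltnS ltnW // index_mem.
exists [ffun i => Ordinal (lt i)] => i.
by rewrite ffunE /= nth_index.
Qed.

(** Scaling the variables by [c] sends [G i - 'X_i] to [c ^+ D *: G i - c *: 'X_i], so the roots of
    unity with [c ^+ D.-1 = 1] act on the fixed point scheme. *)
Lemma scale_fixed_ideal (K : fieldType) (n D : nat) (G : 'I_n -> {mpoly K[n]}) c f :
    (forall i, G i \is D.-homog) -> c ^+ D = c ->
    family_ideal (fun i => G i - 'X_i) f ->
  family_ideal (fun i => G i - 'X_i) (subst (fun i => c *: 'X_i) f).
Proof.
move=> hG cD [a ->]; exists (fun i => c *: subst (fun i => c *: 'X_i) (a i)).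
rewrite rmorph_sum; apply: eq_bigr => i _.
rewrite rmorphM rmorphB /= substXU (subst_scale_homog _ (hG i)) cD.
by rewrite -scalerBr -scalerAl scalerAr.
Qed.

Lemma homog_eval0 (K : fieldType) (n D : nat) (f : {mpoly K[n]}) :
  (0 < D)%N -> f \is D.-homog -> f.@[fun=> 0] = 0.
Proof.
move=> D0 hf; transitivity (f.@[fun i => 0 * (fun=> 0) i]).
  by apply: meval_eq => i; rewrite mul0r.
by rewrite (meval_scale_homog _ _ hf) expr0n gtn_eqF // mul0r.
Qed.

Lemma meval_ideal (K : fieldType) (n : nat) (v : 'I_n -> K) :
  is_ideal (fun f : {mpoly K[n]} => f.@[v] = 0).
Proof.
split=> [|f g f0 g0|f g g0]; first exact: meval0.
  by rewrite mevalD f0 g0 addr0.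
by rewrite mevalM g0 mulr0.
Qed.

(** There are [D.-1] roots with multiplicity; the spare index returns the default [0]. This list
    accounts for the single factor [D] in the final count. *)
Lemma root_of_unity_list (K : closedFieldType) (D : nat) : (1 < D)%N ->
  exists z : 'I_D -> K, forall x, x ^+ D.-1 = 1 -> exists j, z j = x.
Proof.
move=> D1; pose p : {poly K} := 'X^(D.-1) - 1.
have sp : size p = D by rewrite size_XnsubC; case: (D) D1 => [|[|m]].
have p0 : p != 0 by rewrite -size_poly_gt0 sp ltnW.
have [rs rsE] := closed_field_poly_normal p.
exists (fun j => nth 0 rs j) => x xD.
have xr : x \in rs.
  have: root p x by rewrite /root !hornerE xD subrr.
  by rewrite rsE rootZ ?root_prod_XsubC // lead_coef_eq0.
have lt : (index x rs < D)%N.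
  rewrite -sp rsE size_scale ?lead_coef_eq0 // size_prod_XsubC.
  by rewrite ltnS ltnW // index_mem.
by exists (Ordinal lt); rewrite nth_index.
Qed.

(** [iter_difference] writes the generators for [F^q] as [B] applied to those for [F], with [B]
    invertible at [v] for large primes [q]. Cramer's rule inverts this up to the factor
    [b = \det B]. *)
Lemma fixed_point_local_ideal (K : closedFieldType) (N : nat)
    (F : 'I_N.+1 -> {mpoly K[N.+1]}) (v : 'I_N.+1 -> K) :
    eval_map F v =1 v ->
  exists M, forall q, (M < q)%N -> prime q ->
    exists2 b, b.@[v] != 0 & forall f, family_ideal (fun i => F i - 'X_i) f ->
      family_ideal (fun i => iter_map F q i - 'X_i) (b * f).
Proof.
move=> Fv; have [A AP] := iter_difference Fv.
have [M hM] := det_power_sum_neq0 A.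
exists M => q Mq pq; have [B [Bv BE]] := AP q.
exists (\det B); first by rewrite -det_map_mx Bv; apply: hM.
move=> f [a ->]; rewrite mulr_sumr; apply: ideal_sum => [|i _].
  exact: family_idealP.
rewrite mulrCA; case: (family_idealP (fun i => iter_map F q i - 'X_i)) => _ _; apply.
exists (fun j => \adj B i j).
pose g : 'cV[{mpoly K[N.+1]}]_N.+1 := \col_j (F j - 'X_j).
have := congr1 (fun X => (X *m g) i 0) (mul_adj_mx B).
rewrite -mulmxA mul_scalar_mx !mxE => <-.
apply: eq_bigr => j _; congr (_ * _); rewrite mxE BE.
by apply: eq_bigr => l _; rewrite mxE.
Qed.

(** The vector spans a line that the induced projective map does not fix but its [q]-th iterate
    does. *)
Lemma affine_periodic_point (K : closedFieldType) (N : nat) (d : nat)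
    (F : 'I_N.+1 -> {mpoly K[N.+1]}) :
    (0 < N)%N -> (1 < d)%N -> (forall i, F i \is d.-homog) ->
    (forall v : 'I_N.+1 -> K, (exists i, v i != 0) -> exists i, (F i).@[v] != 0) ->
  exists M, forall q, prime q -> (M < q)%N -> exists v : 'I_N.+1 -> K,
    [/\ exists i, v i != 0, iter q (eval_map F) v =1 v
      & ~ exists c, eval_map F v =1 (fun i => c * v i)].
Proof.
move=> N0 d1 hF nz; set n := N.+1.
have [e1 [_ red1]] := fixed_ideal_reduction d1 hF nz.
have II1 := family_idealP (fun i => F i - 'X_i).
have [chi chi0 Ichi] := fin_all_exists2 (reducible_ideal_zero II1 red1).
have [z zP] := zero_coordinate_mem chi0 Ichi.
set k := \max_j size (chi j) in z zP *.
(* The candidates [z a] are finitely many and independent of [q], so one [M] serves them all; those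
   not fixed by [F] satisfy the claim vacuously. *)
have [|M hM] := @uniform_bound _ (enum {: {ffun 'I_n -> 'I_k}})
  (fun a q => eval_map F (z a) =1 z a -> prime q ->
    exists2 b, b.@[z a] != 0 & forall f, family_ideal (fun i => F i - 'X_i) f ->
      family_ideal (fun i => iter_map F q i - 'X_i) (b * f)).
  move=> a _; have [Fz|nFz] := classic (eval_map F (z a) =1 z a).
    by have [M hM] := fixed_point_local_ideal Fz; exists M => q Mq _; apply: hM.
  by exists 0%N.
(* With [k ^ n * D * k ^ n] functionals, the bound from [degree_count] is [D * kappa]. *)
pose kappa := (k ^ n * k ^ n * (2 * n) ^ n)%N.
exists (maxn M kappa) => q pq; rewrite gtn_max => /andP [Mq kq].
apply: NNPP => none.
pose D := (d ^ q)%N; pose G := iter_map F q.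
have qD : (q < D)%N by apply: ltn_expl.
have D1 : (1 < D)%N by apply: leq_ltn_trans qD; apply: prime_gt0.
have hG : forall i, G i \is D.-homog by apply: iter_map_homog.
have nzG := iter_map_nonzero nz q.
have [e [gen red]] := fixed_ideal_reduction D1 hG nzG.
set I := family_ideal (fun i => G i - 'X_i) in red.
have II : is_ideal I by apply: family_idealP.
have [zeta zetaP] := root_of_unity_list K D1.
(* These are the Taylor coefficients with all exponents below [k] at the points [zeta * z a]: [J.1]
   chooses the point and [J.2] the exponents. *)
pose ell (J : {ffun 'I_n -> 'I_k} * 'I_D * {ffun 'I_n -> 'I_k}) (f : {mpoly K[n]}) :=
  (subst (fun i => 'X_i + (zeta J.1.2 * z J.1.1 i)%:MP) f)@_
    [multinom val (J.2 i) | i < n].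
have zero_form v : (forall f, I f -> f.@[v] = 0) -> exists (u : 'I_n -> K) c,
    [/\ eval_map F u =1 u, c ^+ D.-1 = 1 & v =1 (fun i => c * u i)].
  move=> vI.
  have Gv i : (G i).@[v] = v i.
    have := vI _ (family_ideal_mem (fun i => G i - 'X_i) i).
    by rewrite mevalB mevalXU => /eqP; rewrite subr_eq0 => /eqP.
  have [v0|nv] := classic (exists i, v i != 0); last first.
    have v0 i : v i = 0 by apply/eqP; apply: NNPP => /negP h; apply: nv; exists i.
    exists (fun=> 0), 1; rewrite expr1n; split=> // i; last by rewrite v0 mulr0.
    by apply: homog_eval0 (hF i); apply: ltnW.
  have [c Fv] : exists c, eval_map F v =1 (fun i => c * v i).
    apply: NNPP => nc; apply: none; exists v; split=> // i.
    by rewrite -eval_iter_map Gv.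
  have c0 : c != 0.
    have [i hi] := nz v v0; apply: contraNneq hi => c0.
    by rewrite -/(eval_map F v i) Fv c0 mul0r.
  (* This choice makes [x v] a fixed point: [F (x v) = x^d c v = x v]. *)
  have [x xE] : exists x : K, x ^+ d.-1 = c^-1.
    have /closed_rootP [x] : size ('X^(d.-1) - (c^-1)%:P) != 1%N.
      by rewrite size_XnsubC; move: d1; case: (d) => [|[|m]].
    by rewrite /root !hornerE subr_eq0 => /eqP xE; exists x.
  have x0 : x != 0.
    apply: contraNneq c0 => x0; rewrite -invr_eq0 -xE x0 expr0n.
    by move: d1; case: (d) => [|[|m]].
  have Fxv : eval_map F (fun i => x * v i) =1 (fun i => x * v i).
    move=> i; rewrite /eval_map (meval_scale_homog x v (hF i)).
    rewrite -/(eval_map F v i) Fv mulrA; congr (_ * _).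
    by rewrite -(prednK (ltnW d1)) exprSr xE mulrAC mulVf // mul1r.
  exists (fun i => x * v i), x^-1; split=> // [|i]; last by rewrite mulKf.
  (* [G] fixes both [v] and [x v], while homogeneity gives [G (x v) = x^D v]; comparing at a nonzero
     coordinate yields [x^(D-1) = 1]. *)
  have [i vi] := v0; rewrite exprVn; apply: (can_inj invrK); rewrite invrK invr1.
  apply: (mulfI x0); rewrite -exprS prednK ?(ltnW D1) // mulr1.
  apply: (mulIf vi); rewrite -{1}(Gv i) -(meval_scale_homog x v (hG i)).
  exact: eval_iter_fixed.
have kerI f : (forall J, ell J f = 0) -> I f.
  move=> f0; apply: (local_membership II red) => v vI.
  have [u [c [Fu cD vE]]] := zero_form v vI.
  have c0 : c != 0.
    apply: contra_eq_neq cD => ->; rewrite expr0n eq_sym.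
    by move: D1; case: (D) => [|[|m]]; rewrite ?oner_eq0.
  have [a ua] : exists a, u =1 z a.
    apply: zP => g; apply: (family_ideal_sub (meval_ideal u)) => i.
    by rewrite mevalB mevalXU -/(eval_map F u i) Fu subrr.
  have za : eval_map F (z a) =1 z a.
    by move=> i; rewrite -[RHS]ua -[RHS]Fu; apply: meval_eq => j; rewrite ua.
  have [b bz bI] := hM a (mem_enum _ a) q Mq za pq.
  have [h hz hI] := fixed_point_multiplicity (z a) II1 chi0 Ichi.
  have [j cj] := zetaP c cD.
  (* [h] carries the [k]-th powers at [z a] into the ideal of [F - X], and [b] carries that ideal
     into [I]. Substituting [c^-1 *: 'X_i], which preserves [I], transports this from [z a] to
     [v = c * z a]. *)
  exists (subst (fun i => c^-1 *: 'X_i) (b * h)).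
    rewrite meval_subst (meval_eq (v2 := z a)) => [|i].
      by rewrite mevalM mulf_neq0.
    by rewrite mevalZ mevalXU vE mulKf.
  apply: (shift_kernel (k := k) (y := fun i => c * z a i) II) => [i|m]; last first.
    by rewrite -(f0 (a, j, m)) /ell /= cj.
  have cVD : c^-1 ^+ D = c^-1.
    by rewrite -(prednK (ltnW D1)) exprS exprVn cD invr1 mulr1.
  have := scale_fixed_ideal hG cVD (bI _ (hI i)); rewrite mulrA.
  rewrite rmorphM rmorphXn rmorphB /= substXU substC -/k.
  set t := subst _ _ => It.
  have -> : 'X_i - (c * z a i)%:MP = c *: (c^-1 *: 'X_i - (z a i)%:MP).
    by rewrite scalerBr scalerA mulfV // scale1r -mul_mpolyC mpolyCM.
  rewrite exprZn -scalerAr -mul_mpolyC; case: II => _ _; exact.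
have H0 i : (G i - 'X_i).@[fun=> 0] = 0.
  by rewrite mevalB mevalXU (homog_eval0 _ (hG i)) ?subrr // ltnW.
have linell J c f g : ell J (c *: f + g) = c * ell J f + ell J g.
  by rewrite /ell rmorphD /= substZ mcoeffD mcoeffZ.
(* The resulting [D ^ n <= D * kappa] contradicts [kappa < q < D <= D ^ N], where the last
   inequality comes from [0 < N]. *)
have := degree_count (ltn0Sn N) (ltnW D1) H0 gen linell kerI.
rewrite !card_prod !card_ffun !card_ord -/n leqNgt => /negP; apply.
have -> : (k ^ n * D * k ^ n * (2 * n) ^ n = D * kappa)%N.
  by rewrite /kappa (mulnC (k ^ n)%N D) -!mulnA.
have -> : (D ^ n = D * D ^ N)%N by rewrite /n expnS.
rewrite ltn_pmul2l ?(ltnW D1) //.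
apply: (leq_trans kq); apply: leq_trans (ltnW qD) _.
by rewrite -{1}(expn1 D) leq_exp2l.
Qed.

(** * Periodic points *)

Lemma iter_mul_fixed (T : Type) (f : T -> T) (P : T) a m :
  iter a f P = P -> iter (m * a) f P = P.
Proof. by move=> fP; elim: m => // m IH; rewrite mulSn iterD IH fP. Qed.

Lemma coprime_iter_fixed (T : Type) (f : T -> T) (P : T) a b :
    (0 < a)%N -> coprime a b -> iter a f P = P -> iter b f P = P ->
  f P = P.
Proof.
move=> a0 /eqP cop fa fb; have [u w e _] := egcdnP b a0.
have := iter_mul_fixed u fa; rewrite e cop addn1 iterS.
by rewrite (iter_mul_fixed w fb).
Qed.

Lemma primitive_period_inj (T : Type) (f : T -> T) (P : T) q r :
  primitive_period f q P -> primitive_period f r P -> q = r.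
Proof.
move=> [q0 fq hq] [r0 fr hr].
by case: (ltngtP q r) => // lt; [case: (hr q); rewrite ?q0|case: (hq r); rewrite ?r0].
Qed.

Lemma morphism_iter (K : fieldType) (N : nat) (phi : proj_space K N -> proj_space K N)
    (F : 'I_N.+1 -> {mpoly K[N.+1]}) (P : proj_space K N) (v : 'I_N.+1 -> K) :
    (forall v : 'I_N.+1 -> K, (exists i, v i != 0) -> exists i, (F i).@[v] != 0) ->
    (forall (P : proj_space K N) (x : 'rV[K]_N.+1), x \in val P -> x != 0 ->
       val (phi P) = <[\row_i (F i).@[x ord0]]>%VS) ->
    (exists i, v i != 0) -> val P = <[\row_i v i]>%VS ->
  forall s, val (iter s phi P) = <[\row_i iter s (eval_map F) v i]>%VS.
Proof.
move=> nz phiE v0 PE; elim=> // s IH.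
set w := iter s _ v in IH.
have [i wi] : exists i, w i != 0.
  have [i hi] := iter_map_nonzero nz s v0.
  by exists i; rewrite /w -eval_iter_map.
have w0 : \row_i w i != 0 by apply/rV0Pn; exists i; rewrite mxE.
rewrite iterS (phiE _ (\row_i w i)) // ?IH ?memv_line //.
congr <[_]>%VS; apply/rowP => j; rewrite !mxE iterS -/w.
by apply: meval_eq => l; rewrite mxE.
Qed.

(** Take the line spanned by the vector from [affine_periodic_point]. A period [r < q] would be
    coprime to the prime [q], so [phi] itself would fix the line and [F v] would be a multiple of
    [v]. *)
Lemma prime_primitive_period (K : closedFieldType) (N d : nat)
    (phi : proj_space K N -> proj_space K N) :
    (0 < N)%N -> (1 < d)%N -> morphism_of_degree d phi ->
  exists M, forall q, prime q -> (M < q)%N -> exists P, primitive_period phi q P.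
Proof.
move=> N0 d1 [F [hF nzF phiE]].
have nz (v : 'I_N.+1 -> K) : (exists i, v i != 0) -> exists i, (F i).@[v] != 0.
  case=> i vi; have [|j hj] := nzF (\row_i v i).
    by apply/rV0Pn; exists i; rewrite mxE.
  by exists j; rewrite -(meval_eq (v1 := (\row_i v i) ord0)) // => l; rewrite mxE.
have [M hM] := affine_periodic_point N0 d1 hF nz.
exists M => q pq Mq; have [v [v0 vq nv]] := hM q pq Mq.
have w0 : \row_i v i != 0 by have [i vi] := v0; apply/rV0Pn; exists i; rewrite mxE.
have dimP : \dim <[\row_i v i]> == 1%N by rewrite dim_vline w0.
pose P : proj_space K N :=
  exist (fun L : {vspace 'rV[K]_N.+1} => \dim L == 1%N) _ dimP.
have phiP := morphism_iter (P := P) nz phiE v0 erefl.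
have fq : iter q phi P = P.
  by apply: val_inj; rewrite phiP; congr <[_]>%VS; apply/rowP => i; rewrite !mxE vq.
exists P; split=> [||r /andP [r0 rq] fr] //; first exact: prime_gt0.
apply: nv; have fP : phi P = P.
  apply: (coprime_iter_fixed r0 _ fr fq).
  by rewrite coprime_sym prime_coprime // gtnNdvd.
have := phiP 1%N; rewrite /= fP /= => PE.
have : \row_i eval_map F v i \in <[\row_i v i]>%VS by rewrite PE memv_line.
case/vlineP => c /rowP cE; exists c => i.
by have := cE i; rewrite !mxE.
Qed.

Theorem theorem4p21 (K : closedFieldType) (N : nat) (hN : (0 < N)%N)
    (d : nat) (hd : (1 < d)%N)
    (phi : proj_space K N -> proj_space K N)
    (hphi : morphism_of_degree d phi)
    (hnd : forall n : nat, (1 <= n)%N -> non_degenerate (iter n phi)) :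
  [/\ forall m : nat, exists q : nat, (m < q)%N /\
        exists P : proj_space K N, primitive_period phi q P,
      infinitely_many (periodic_point phi)
    & exists M : nat, forall q : nat, prime q -> (M < q)%N ->
        exists P : proj_space K N, primitive_period phi q P].
Proof.
have [M hM] := prime_primitive_period hN hd hphi.
have large m : exists q, (m < q)%N /\
    exists P : proj_space K N, primitive_period phi q P.
  have [q] := prime_above (maxn m M).
  by rewrite gtn_max => /andP [mq Mq] pq; exists q; split=> //; apply: hM.
split=> //; last by exists M.
(* The primitive periods occurring in a finite list are bounded, so a point of larger primitive
   period lies outside it; points without a primitive period get the bound [0]. *)
move=> s; have [|B hB] := @uniform_bound _ s (fun P q => ~ primitive_period phi q P).
  move=> P _; have [[r Pr]|none] := classic (exists r, primitive_period phi r P).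
    by exists r => q rq /(primitive_period_inj Pr) rE; rewrite rE ltnn in rq.
  by exists 0%N => q _ Pq; apply: none; exists q.
have [q [Bq [P Pq]]] := large B.
exists P; first by case: Pq => q0 fq _; exists q.
by apply/negP => Ps; apply: hB Ps q Bq Pq.
Qed.
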